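(* Let $\mu$ be a signed measure on $\mathcal B([0,1]^2)$ induced by some measure-inducing bivariate quasi-copula. Then $\mu$ can be expressed as $\mu=\sum_{n=1}^\infty\gamma_n\mu_n$, where each $\mu_n$ is a measure induced by some bivariate copula, each $\gamma_n$ is a real number, and the series converges in the total variation norm.
   Context: A function $Q\colon[0,1]^2\to[0,1]$ is a (bivariate) quasi-copula if: $Q(x,0)=Q(0,y)=0$ for all $x,y\in[0,1]$; $Q(x,1)=x$ and $Q(1,y)=y$ for all $x,y\in[0,1]$; $Q$ is increasing (nondecreasing) in each variable; and $|Q(x_2,y_2)-Q(x_1,y_1)|\le|x_2-x_1|+|y_2-y_1|$ for all $x_1,y_1,x_2,y_2\in[0,1]$. A function $C\colon[0,1]^2\to[0,1]$ is a (bivariate) copula if it satisfies the first two of these conditions and $C(x_2,y_2)-C(x_1,y_2)-C(x_2,y_1)+C(x_1,y_1)\ge0$ whenever $x_1\le x_2$ and $y_1\le y_2$. A quasi-copula $Q$ induces a signed measure $\mu_Q$ on the Borel $\sigma$-algebra $\mathcal B([0,1]^2)$ (and is then called measure-inducing) if $\mu_Q([0,x]\times[0,y])=Q(x,y)$ for all $x,y\in[0,1]$; every copula induces a positive measure in this sense. The total variation norm of a finite signed measure $\mu$ with Jordan decomposition $\mu=\mu^+-\mu^-$ is $\|\mu\|_{TV}=\mu^+([0,1]^2)+\mu^-([0,1]^2)$. *)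

(* Defs.v *)
From HB Require Import structures.
From mathcomp Require Export all_boot all_order all_algebra.
From mathcomp Require Export all_classical all_reals all_analysis.

Set Implicit Arguments.
Unset Strict Implicit.
Unset Printing Implicit Defensive.

Import Order.TTheory GRing.Theory Num.Theory.
Import numFieldNormedType.Exports.

Local Open Scope classical_set_scope.
Local Open Scope ring_scope.

Definition unit_square (R : realType) : set (R * R) :=
  `[0, 1]%classic `*` `[0, 1]%classic.
Arguments unit_square R : clear implicits.

Fact unit_square00 (R : realType) : (0, 0) \in unit_square R.
Proof. by rewrite inE; split; rewrite /= in_itv /= lexx ler01. Qed.

(* A pointed copy of the subtype of [R * R] on [unit_square R], with its library
   topology, the one induced by the product topology; the base point is only
   there because the library's generated sigma-algebras require one. *)
Definition square (R : realType) : Type := set_type (unit_square R).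

HB.instance Definition _ (R : realType) := Topological.on (square R).
HB.instance Definition _ (R : realType) :=
  isPointed.Build (square R) (exist _ (0, 0) (unit_square00 R)).

(* The measurable sets of this type are the Borel sets of [0, 1]^2. *)
Definition borel_square (R : realType) :=
  g_sigma_algebraType (@open (square R)).

HB.instance Definition _ (R : realType) := Measurable.on (borel_square R).

(* Functions [0, 1]^2 -> [0, 1] are encoded as total functions [R -> R -> R], of
   which only the values on [0, 1]^2 matter. *)
Section copulas.
Variable R : realType.
Implicit Types F Q C : R -> R -> R.

Definition square_to_unit F := forall x y,
  x \in `[0, 1] -> y \in `[0, 1] -> F x y \in `[0, 1].

Definition grounded F := forall x y,
  x \in `[0, 1] -> y \in `[0, 1] -> F x 0 = 0 /\ F 0 y = 0.

Definition uniform_margins F := forall x y,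
  x \in `[0, 1] -> y \in `[0, 1] -> F x 1 = x /\ F 1 y = y.

Record quasi_copula Q : Prop := QuasiCopula {
  quasi_copula_range : square_to_unit Q ;
  quasi_copula_grounded : grounded Q ;
  quasi_copula_margins : uniform_margins Q ;
  quasi_copula_nondecreasingl : forall x1 x2 y,
    x1 \in `[0, 1] -> x2 \in `[0, 1] -> y \in `[0, 1] ->
    x1 <= x2 -> Q x1 y <= Q x2 y ;
  quasi_copula_nondecreasingr : forall x y1 y2,
    x \in `[0, 1] -> y1 \in `[0, 1] -> y2 \in `[0, 1] ->
    y1 <= y2 -> Q x y1 <= Q x y2 ;
  quasi_copula_lipschitz : forall x1 y1 x2 y2,
    x1 \in `[0, 1] -> y1 \in `[0, 1] -> x2 \in `[0, 1] -> y2 \in `[0, 1] ->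
    `|Q x2 y2 - Q x1 y1| <= `|x2 - x1| + `|y2 - y1| }.

Record copula C : Prop := Copula {
  copula_range : square_to_unit C ;
  copula_grounded : grounded C ;
  copula_margins : uniform_margins C ;
  copula_2increasing : forall x1 x2 y1 y2,
    x1 \in `[0, 1] -> x2 \in `[0, 1] -> y1 \in `[0, 1] -> y2 \in `[0, 1] ->
    x1 <= x2 -> y1 <= y2 ->
    0 <= C x2 y2 - C x1 y2 - C x2 y1 + C x1 y1 }.

Definition induces F (mu : set (borel_square R) -> \bar R) := forall x y,
  x \in `[0, 1] -> y \in `[0, 1] ->
  mu (set_val @^-1` (`[0, x]%classic `*` `[0, y]%classic)) = (F x y)%:E.

End copulas.

Section total_variation.
Context d (T : measurableType d) (R : realType).
Implicit Types nu : {charge set T -> \bar R}.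

(* By [Hahn_decomposition_uniq], independent of the chosen decomposition. *)
Definition tv_norm nu : \bar R :=
  let P := cid (Hahn_decomposition nu) in
  let N := cid (projT2 P) in
  charge_variation (projT2 N) setT.

Fixpoint charge_partial_sum (nu : nat -> {charge set T -> \bar R}) (n : nat) :
    {charge set T -> \bar R} :=
  if n is m.+1 then cadd (charge_partial_sum nu m) (nu m) else czero.

Definition tv_series_cvg_to (nu : nat -> {charge set T -> \bar R})
    (mu : {charge set T -> \bar R}) :=
  (fun n => tv_norm (cadd (charge_partial_sum nu n) (copp mu))) @ \oo --> 0%E.

End total_variation.

(* Main.v *)
From HB Require Import structures.
Require Import Defs.
From mathcomp Require Import measurable_realfun ring lra.

(* Write [mu = mu^+ - mu^-].  Since [Q] is nondecreasing and 1-Lipschitz, both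
   margins of [|mu|] are absolutely continuous, hence there is a weight
   [0 < g <= 1] on the square such that [g |mu|] has margins dominated by the
   Lebesgue measure.  With [t_n = \sum_(k < n) 1 / (k + 1)] and
   [W_n = min(1, t_n g)], the pieces [(W_(n+1) - W_n) mu^+-] have margins
   dominated by [c_n = 1 / (n + 1)] times the Lebesgue measure, and the
   remainders [(1 - W_n) mu^+-] tend to 0 in total variation.

   For a finite measure [nu] of mass [m] with margins [nu_x], [nu_y], put
   [D(nu) = nu + m U - nu_x (x) lambda - lambda (x) nu_y], where [U] is the
   uniform measure on the square.  [D] is additive, its values have null
   margins, and if the margins of [nu] are at most [c lambda] then
   [D(nu) + 2 c U] is [2 c] times a measure induced by a copula.  Therefore
   [D] of the difference of the n-th pieces is [2 c_n (E_n - F_n)] for two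
   copula measures [E_n] and [F_n]; these differences telescope, and
   [mu = U + \sum_n 2 c_n (E_n - F_n)].  The series of single terms still
   converges because [c_n] tends to 0. *)

Set Implicit Arguments.
Unset Strict Implicit.
Unset Printing Implicit Defensive.

Import Order.TTheory GRing.Theory Num.Theory.
Import numFieldNormedType.Exports.

Local Open Scope classical_set_scope.
Local Open Scope ring_scope.

(** * The Borel sigma-algebra of the square *)

(** Every point of [U] lies in a box with rational corners contained in [U], and there are countably
    many such boxes. *)
Lemma open_prod_measurable (R : realType) (U : set (R * R)) :
  open U -> measurable U.
Proof.
move=> oU.
pose B (q : (rat * rat) * (rat * rat)) : set (R * R) :=
  `](ratr q.1.1 : R), ratr q.1.2[%classic `*` `](ratr q.2.1 : R), ratr q.2.2[%classic.
have -> : U = \bigcup_q (if `[< B q `<=` U >] then B q else set0).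
  apply/seteqP; split => [[x y] Uxy|z [q _]]; last first.
    by case: asboolP => // BU; exact: BU.
  have [[V W] /= [Vx Wy] VWU] : nbhs (x, y) U by exact: open_nbhs_nbhs.
  have /nbhs_ballP[e /= e0 Ve] := Vx; have /nbhs_ballP[f /= f0 Wf] := Wy.
  have [|a] := @rat_in_itvoo R (x - e) x; first by rewrite ltrBlDr ltrDl.
  rewrite in_itv /= => /andP[a1 a2].
  have [|b] := @rat_in_itvoo R x (x + e); first by rewrite ltrDl.
  rewrite in_itv /= => /andP[b1 b2].
  have [|c] := @rat_in_itvoo R (y - f) y; first by rewrite ltrBlDr ltrDl.
  rewrite in_itv /= => /andP[c1 c2].
  have [|d] := @rat_in_itvoo R y (y + f); first by rewrite ltrDl.
  rewrite in_itv /= => /andP[d1 d2].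
  exists ((a, b), (c, d)) => //.
  case: asboolP => [_|[]].
    by rewrite /B; split; rewrite /= in_itv /=; apply/andP.
  move=> [u v] [] /=; rewrite !in_itv /= => /andP[u1 u2] /andP[v1 v2].
  by apply: VWU; split => /=; [apply: Ve|apply: Wf]; rewrite /ball /= ltr_norml;
    apply/andP; split; lra.
apply: countable_bigcupT_measurable; first exact: countableP.
move=> q; case: asboolP => // _.
by apply: measurableX; exact: measurable_itv.
Qed.

Section square_sigma_algebra.
Variable R : realType.
Local Notation S := (borel_square R).
Implicit Types (x y : R) (s : S).

Definition sqx s : R := (set_val s : R * R).1.
Definition sqy s : R := (set_val s : R * R).2.

Lemma sqx_itv s : sqx s \in `[0, 1].
Proof. by have [] : unit_square R (set_val s) := set_valP s. Qed.

Lemma sqy_itv s : sqy s \in `[0, 1].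
Proof. by have [] : unit_square R (set_val s) := set_valP s. Qed.

Definition box x y : set S := sqx @^-1` `[0, x] `&` sqy @^-1` `[0, y].

Definition boxes : set (set S) :=
  [set A | exists x y, [/\ x \in `[0, 1], y \in `[0, 1] & A = box x y]].

Lemma open_square_measurable (V : set (R * R)) :
  open V -> measurable (set_val @^-1` V : set S).
Proof. by move=> oV; apply: sub_sigma_algebra; exists V. Qed.

Lemma measurable_sqx : measurable_fun setT sqx.
Proof.
apply: (measurability _ (RGenOpens.measurableE R)) => _ [_ [a [b ->] <-]].
rewrite setTI; apply: (@open_square_measurable (fst @^-1` `]a, b[%classic)).
by apply: open_comp; [move=> ? _; exact: cvg_fst|exact: interval_open].
Qed.

Lemma measurable_sqy : measurable_fun setT sqy.
Proof.
apply: (measurability _ (RGenOpens.measurableE R)) => _ [_ [a [b ->] <-]].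
rewrite setTI; apply: (@open_square_measurable (snd @^-1` `]a, b[%classic)).
by apply: open_comp; [move=> ? _; exact: cvg_snd|exact: interval_open].
Qed.

Lemma measurable_sqx_preimage (A : set R) :
  measurable A -> measurable (sqx @^-1` A).
Proof. by move=> mA; rewrite -[X in measurable X]setTI; exact: measurable_sqx. Qed.

Lemma measurable_sqy_preimage (A : set R) :
  measurable A -> measurable (sqy @^-1` A).
Proof. by move=> mA; rewrite -[X in measurable X]setTI; exact: measurable_sqy. Qed.

Lemma measurable_box x y : measurable (box x y).
Proof.
by apply: measurableI; [exact: measurable_sqx_preimage|exact: measurable_sqy_preimage].
Qed.

Lemma boxesI : setI_closed boxes.
Proof.
move=> _ _ [x [y [x01 y01 ->]]] [x' [y' [x'01 y'01 ->]]].
exists (Num.min x x'), (Num.min y y'); split.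
- by case: (leP x x').
- by case: (leP y y').
- rewrite /box; apply/seteqP; split => s /=; rewrite !in_itv /= !le_min.
    by case=> -[/andP[-> ->] /andP[-> ->]] [/andP[_ ->] /andP[_ ->]].
  by case=> /and3P[-> -> ->] /and3P[-> -> ->].
Qed.

Lemma box11 : box 1 1 = setT.
Proof.
by apply/seteqP; split => // s _; split; rewrite /=; [exact: sqx_itv|exact: sqy_itv].
Qed.

(** Boxes with one side equal to 1 are the sublevel sets of a coordinate, so both coordinates are
    measurable for the sigma-algebra generated by [boxes]. Hence so is the inclusion into the plane,
    and traces of open sets belong to it. *)
Lemma measurable_square : @measurable _ S = <<s boxes>>.
Proof.
apply/seteqP; split; apply: smallest_sub; try exact: smallest_sigma_algebra; last first.
  by move=> _ [x [y [_ _ ->]]]; exact: measurable_box.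
move=> _ [V oV <-].
pose S' := g_sigma_algebraType boxes.
have generated (f : S -> R) : (forall s, f s \in `[0, 1]) ->
    (forall a, a \in `[0, 1] -> boxes (f @^-1` `[0, a])) ->
    measurable_fun setT (f : S' -> R).
  move=> f01 boxf; apply: (measurability _ (RGenOInfty.measurableE R)).
  move=> _ [_ [a ->] <-]; rewrite setTI.
  have [a0|a0] := ltP a 0.
    rewrite [X in measurable X](_ : _ = setT); first exact: measurableT.
    apply/seteqP; split => // s _ /=; have := f01 s.
    by rewrite !in_itv /= => /andP[s0 _]; rewrite andbT (lt_le_trans a0).
  (* Truncation at 1 keeps the side of the box in the unit interval, and does not change the set
     because [f] is at most 1. *)
  rewrite [X in measurable X](_ : _ = ~` (f @^-1` `[0, Num.min a 1])).
    apply: measurableC; apply: sub_sigma_algebra; apply: boxf.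
    by case: (leP a 1) => a1; rewrite in_itv /= ?a0 ?a1 ?ler01 ?lexx.
  apply/seteqP; split => s /=; have := f01 s; rewrite !in_itv /= => /andP[s0 s1];
    rewrite s0 le_min s1 !andbT /=.
    by move=> sa; apply/negP; rewrite -ltNge.
  by move/negP; rewrite -ltNge.
have mx : measurable_fun setT (sqx : S' -> R).
  apply: generated => [|a a01]; first exact: sqx_itv.
  exists a, 1; split => //; first by rewrite in_itv /= ler01 lexx.
  rewrite /box; apply/seteqP; split => s /=; last by case.
  by move=> ?; split => //; exact: sqy_itv.
have my : measurable_fun setT (sqy : S' -> R).
  apply: generated => [|a a01]; first exact: sqy_itv.
  exists 1, a; split => //; first by rewrite in_itv /= ler01 lexx.
  rewrite /box; apply/seteqP; split => s /=; last by case.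
  by move=> ?; split => //; exact: sqx_itv.
have := measurable_fun_pair mx my measurableT (open_prod_measurable oV).
rewrite setTI; congr measurable.
by apply/seteqP; split => s /=; rewrite /sqx /sqy -surjective_pairing.
Qed.

Lemma finite_measure_ext (m1 m2 : {finite_measure set S -> \bar R}) :
  (forall x y, x \in `[0, 1] -> y \in `[0, 1] -> m1 (box x y) = m2 (box x y)) ->
  forall A, measurable A -> m1 A = m2 A.
Proof.
move=> m12 A mA; apply: (measure_unique boxes (fun=> setT)) => //.
- exact: measurable_square.
- exact: boxesI.
- by move=> _; exists 1, 1; rewrite box11 in_itv /= ler01 lexx.
- by rewrite bigcup_const //; exists 0%N.
- by move=> _ [x [y [x01 y01 ->]]]; exact: m12.
- by move=> _; rewrite -ge0_fin_numE // fin_num_measure.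
Qed.

(** The positive and negative parts of [n1 - n2] are finite measures that agree on boxes, hence
    everywhere. Identities between charges are thereby reduced to boxes. *)
Lemma charge_ext (n1 n2 : {charge set S -> \bar R}) :
  (forall x y, x \in `[0, 1] -> y \in `[0, 1] -> n1 (box x y) = n2 (box x y)) ->
  forall A, measurable A -> n1 A = n2 A.
Proof.
move=> n12 A mA; pose n : {charge set S -> \bar R} := cadd n1 (copp n2).
have [P [N PN]] := Hahn_decomposition n.
have nE B : n B = (n1 B - n2 B)%E by [].
have nA : n A = 0%E.
  rewrite (jordan_decomp PN mA) [LHS]/cadd /= cscaleN1 /=.
  rewrite (@finite_measure_ext (jordan_pos PN) (jordan_neg PN)) //.
    by rewrite subee // fin_num_measure.
  move=> x y x01 y01; have mB := measurable_box x y.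
  have := jordan_decomp PN mB; rewrite nE n12 // subee ?fin_num_measure //.
  rewrite /cadd /= cscaleN1 /= => /esym/eqP.
  have /(_ _ mB) finp := fin_num_measure (jordan_pos PN).
  have /(_ _ mB) finn := fin_num_measure (jordan_neg PN).
  by rewrite sube_eq ?fin_num_adde_defl // add0e => /eqP.
have /(_ _ mA) fin2 := fin_num_measure n2.
have /(_ _ mA) fin1 := fin_num_measure n1.
apply/eqP; rewrite -[n2 A]add0e -sube_eq ?fin_num_adde_defl //.
by rewrite -nE nA.
Qed.

End square_sigma_algebra.

Arguments sqx {R} s.
Arguments sqy {R} s.

(** * Measures on the square with prescribed margins *)

Lemma finite_measure_pushforward d d' (T1 : measurableType d)
    (T2 : measurableType d') (R : realType)
    (m : {finite_measure set T1 -> \bar R}) (f : T1 -> T2) :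
  measurable_fun [set: T1] f ->
  exists m' : {finite_measure set T2 -> \bar R}, forall A, m' A = m (f @^-1` A).
Proof.
move=> mf; have foo : (pushforward m f setT < +oo)%E.
  by rewrite /pushforward preimage_setT -ge0_fin_numE // fin_num_measure.
(* Restriction to the whole space changes no value; it packages a measure of finite mass as a finite
   measure. *)
by exists (mfrestr measurableT foo) => A; rewrite -[in RHS](setIT A).
Unshelve. exact: mf.
Qed.

Lemma finite_measure_of_charge d (T : measurableType d) (R : realType)
    (n : {charge set T -> \bar R}) :
  (forall A, measurable A -> (0 <= n A)%E) ->
  exists m : {finite_measure set T -> \bar R},
    forall A, measurable A -> m A = n A.
Proof.
(* [crestr0] is 0 on nonmeasurable sets, so [n'] is nonnegative on every set, as [measure_of_charge]
   requires. *)
move=> n0; pose n' := crestr0 n measurableT.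
have n'E A : measurable A -> n' A = n A.
  by move=> mA; rewrite /n' /crestr0 mem_set // /crestr setIT.
have n'0 A : (0 <= n' A)%E.
  by rewrite /n' /crestr0; case: ifP => // /set_mem mA; rewrite /crestr setIT n0.
have foo : (measure_of_charge n' n'0 setT < +oo)%E.
  by rewrite -ge0_fin_numE // /measure_of_charge n'E // fin_num_measure.
exists (mfrestr measurableT foo) => A mA.
by rewrite -n'E // -[in RHS](setIT A).
Qed.

Lemma finite_measure_prod d d' (T1 : measurableType d) (T2 : measurableType d')
    (R : realType) (m1 : {finite_measure set T1 -> \bar R})
    (m2 : {finite_measure set T2 -> \bar R}) :
  exists m : {finite_measure set (T1 * T2)%type -> \bar R},
    forall A B, measurable A -> measurable B -> m (A `*` B) = (m1 A * m2 B)%E.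
Proof.
have foo : ((m1 \x m2)%E setT < +oo)%E.
  rewrite -ge0_fin_numE // -setXTT product_measure1E //.
  by rewrite fin_numM // fin_num_measure.
exists (mfrestr measurableT foo) => A B mA mB.
by rewrite -product_measure1E // -[in RHS](setIT (A `*` B)).
Qed.

Lemma tv_norm_ge0 d (T : measurableType d) (R : realType)
    (n : {charge set T -> \bar R}) : (0 <= tv_norm n)%E.
Proof. exact: measure_ge0. Qed.

(** The variation of the whole space is [n P - n N] for a Hahn decomposition, and each of the two
    terms is at most [r]. *)
Lemma tv_norm_le d (T : measurableType d) (R : realType)
    (n : {charge set T -> \bar R}) (r : R) :
  (forall A, measurable A -> (`|n A| <= r%:E)%E) -> (tv_norm n <= (2 * r)%:E)%E.
Proof.
move=> nr.
suff H P N (PN : hahn_decomposition n P N) :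
    (charge_variation PN setT <= (2 * r)%:E)%E by exact: H.
have [[mP _] [mN _] _ _] := PN.
rewrite [leLHS](_ : _ = (n P - n N)%E); last first.
  congr (_ + _)%E.
    by rewrite jordan_posE cjordan_posE /crestr0 mem_set // /crestr setTI.
  by rewrite jordan_negE cjordan_negE /crestr0 mem_set // /crestr setTI.
rewrite mulrDl mul1r EFinD; apply: leeD.
  by rewrite (le_trans _ (nr _ mP)) // lee_abs.
by rewrite (le_trans _ (nr _ mN)) // -abseN lee_abs.
Qed.

Section completion.
Variable R : realType.
Local Notation S := (borel_square R).
Local Notation R1 := (measurableTypeR R).
Implicit Types (x y c : R) (s : S) (n : {finite_measure set S -> \bar R}).

(** Retraction of the line onto the unit interval, used to carry measures on the plane to the
    square. *)
Definition clamp (u : R) : R := Num.max 0 (Num.min 1 u).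

Lemma clamp_itv u : clamp u \in `[0, 1].
Proof.
rewrite in_itv /= /clamp; apply/andP; split; first by rewrite le_max lexx.
by rewrite ge_max ler01 ge_min lexx.
Qed.

Lemma clamp_id u : u \in `[0, 1] -> clamp u = u.
Proof.
by rewrite in_itv /= /clamp => /andP[u0 u1]; rewrite min_r // max_r.
Qed.

Lemma nondecreasing_clamp : {homo clamp : u v / u <= v}.
Proof.
move=> u v uv; rewrite /clamp ge_max !le_max lexx /=.
by apply/orP; right; rewrite le_min !ge_min lexx uv !orbT.
Qed.

Lemma measurable_clamp : measurable_fun setT clamp.
Proof. by apply: nondecreasing_measurable => //; exact: nondecreasing_clamp. Qed.

Fact clamp2_subproof (p : R * R) : (clamp p.1, clamp p.2) \in unit_square R.
Proof. by apply: mem_set; split; exact: clamp_itv. Qed.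

Definition clamp2 (p : R * R) : S :=
  exist (fun z => z \in unit_square R) (clamp p.1, clamp p.2) (clamp2_subproof p).

Lemma measurable_clamp2 : measurable_fun setT (clamp2 : (R1 * R1)%type -> S).
Proof.
apply: (@measurability _ _ (R1 * R1)%type S setT clamp2 (@open (square R)) erefl).
move=> _ [_ [V oV <-] <-].
rewrite setTI.
have m1 : measurable_fun setT (fun p : (R1 * R1)%type => clamp p.1).
  by apply: measurableT_comp => //; exact: measurable_clamp.
have m2 : measurable_fun setT (fun p : (R1 * R1)%type => clamp p.2).
  by apply: measurableT_comp => //; exact: measurable_clamp.
have := measurable_fun_pair m1 m2 measurableT (open_prod_measurable oV).
by rewrite setTI.
Qed.

(** For [0 <= x < 1] this is the ray up to [x], and for [x = 1] the whole line. *)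
Definition clamp_seg x : set R := clamp @^-1` `[0, x].

Lemma measurable_clamp_seg x : measurable (clamp_seg x : set R1).
Proof. by rewrite -[clamp_seg x]setTI; exact: measurable_clamp. Qed.

Lemma preimage_clamp2_box x y : clamp2 @^-1` (box x y) = clamp_seg x `*` clamp_seg y.
Proof. by []. Qed.

Lemma sqx_clamp_seg x : sqx @^-1` (clamp_seg x) = sqx @^-1` `[0, x] :> set S.
Proof. by apply/seteqP; split => s; rewrite /clamp_seg /= clamp_id //; exact: sqx_itv. Qed.

Lemma sqy_clamp_seg x : sqy @^-1` (clamp_seg x) = sqy @^-1` `[0, x] :> set S.
Proof. by apply/seteqP; split => s; rewrite /clamp_seg /= clamp_id //; exact: sqy_itv. Qed.

Lemma box1r x : box x 1 = sqx @^-1` `[0, x].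
Proof. by apply/seteqP; split => s /=; [case|split => //; exact: sqy_itv]. Qed.

Lemma box1l y : box 1 y = sqy @^-1` `[0, y].
Proof. by apply/seteqP; split => s /=; [case|split => //; exact: sqx_itv]. Qed.

Fact lebesgue_unit_lty : (lebesgue_measure (`[0%R, 1%R]%classic : set R1) < +oo)%E.
Proof. by rewrite lebesgue_measure_itv /= lte01 /= sube0 ltry. Qed.

Fact measurable_unit : measurable (`[0%R, 1%R]%classic : set R1).
Proof. exact: measurable_itv. Qed.

Definition unit_lebesgue : {finite_measure set R1 -> \bar R} :=
  mfrestr measurable_unit lebesgue_unit_lty.

Lemma unit_lebesgueE A : unit_lebesgue A = lebesgue_measure (A `&` `[0%R, 1%R]).
Proof. by []. Qed.

Lemma unit_lebesgue_clamp_seg x : x \in `[0, 1] -> unit_lebesgue (clamp_seg x) = x%:E.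
Proof.
rewrite in_itv /= => /andP[x0 x1]; rewrite unit_lebesgueE.
rewrite [X in lebesgue_measure X](_ : _ = `[0, x]%classic).
  rewrite lebesgue_measure_itv /= lte_fin; case: ltP => // [_|x0'].
    by rewrite sube0.
  by congr EFin; apply/esym/eqP; rewrite eq_le x0' x0.
apply/seteqP; split => u.
  by rewrite /clamp_seg /= => -[+ u01]; rewrite clamp_id.
move=> ux; have u01 : u \in `[0, 1].
  by move: ux; rewrite /= !in_itv /= => /andP[-> ux]; rewrite (le_trans ux).
by split => //; rewrite /clamp_seg /= clamp_id.
Qed.

(* The product of two measures on the line, pushed to the square along the
   retraction [clamp2]. *)
Lemma square_prod_subproof
    (k l : {finite_measure set R1 -> \bar R}) :
  exists m : {finite_measure set S -> \bar R}, forall x y,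
    m (box x y) = (k (clamp_seg x) * l (clamp_seg y))%E.
Proof.
have [p pE] := finite_measure_prod k l.
have [m mE] := finite_measure_pushforward p measurable_clamp2.
exists m => x y; rewrite mE preimage_clamp2_box pE //; exact: measurable_clamp_seg.
Qed.

Definition square_prod k l := projT1 (cid (square_prod_subproof k l)).

Lemma square_prodE k l x y :
  square_prod k l (box x y) = (k (clamp_seg x) * l (clamp_seg y))%E.
Proof. by rewrite /square_prod; case: cid => m /= ->. Qed.

Definition margin_x n : {finite_measure set R1 -> \bar R} :=
  projT1 (cid (@finite_measure_pushforward _ _ S R1 R n sqx (@measurable_sqx R))).

Lemma margin_xE n A : margin_x n A = n (sqx @^-1` A).
Proof. by rewrite /margin_x; case: cid => m /= ->. Qed.

Definition margin_y n : {finite_measure set R1 -> \bar R} :=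
  projT1 (cid (@finite_measure_pushforward _ _ S R1 R n sqy (@measurable_sqy R))).

Lemma margin_yE n A : margin_y n A = n (sqy @^-1` A).
Proof. by rewrite /margin_y; case: cid => m /= ->. Qed.

Definition uniform_square := square_prod unit_lebesgue unit_lebesgue.

Definition spread_x n := square_prod (margin_x n) unit_lebesgue.

Definition spread_y n := square_prod unit_lebesgue (margin_y n).

Lemma uniform_squareE x y : x \in `[0, 1] -> y \in `[0, 1] ->
  uniform_square (box x y) = (x * y)%:E.
Proof. by move=> x01 y01; rewrite square_prodE !unit_lebesgue_clamp_seg. Qed.

Lemma spread_xE n x y : y \in `[0, 1] ->
  spread_x n (box x y) = (n (box x 1) * y%:E)%E.
Proof.
by move=> y01; rewrite square_prodE unit_lebesgue_clamp_seg // margin_xE sqx_clamp_seg box1r.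
Qed.

Lemma spread_yE n x y : x \in `[0, 1] ->
  spread_y n (box x y) = (x%:E * n (box 1 y))%E.
Proof.
by move=> x01; rewrite square_prodE unit_lebesgue_clamp_seg // margin_yE sqy_clamp_seg box1l.
Qed.

End completion.

(** * Completion to a copula measure *)

Lemma fine_measureK d (T : measurableType d) (R : realType)
    (m : {finite_measure set T -> \bar R}) A :
  measurable A -> m A = (fine (m A))%:E.
Proof. by move=> mA; rewrite fineK // fin_num_measure. Qed.

Section completion_copula.
Variable R : realType.
Local Notation S := (borel_square R).
Local Notation R1 := (measurableTypeR R).
Local Notation U := (uniform_square R).
Implicit Types (x y c : R) (n : {finite_measure set S -> \bar R}).

(* The signed measure [D(n)] of the introduction. *)
Definition completion n : {charge set S -> \bar R} :=
  cadd (cadd (charge_of_finite_measure n)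
             (cscale (fine (n setT)) (charge_of_finite_measure U)))
       (copp (cadd (charge_of_finite_measure (spread_x n))
                   (charge_of_finite_measure (spread_y n)))).

Lemma completionE n A : measurable A ->
  completion n A = (fine (n A) + fine (n setT) * fine (U A) -
                    (fine (spread_x n A) + fine (spread_y n A)))%:E.
Proof.
move=> mA.
have -> : completion n A = (n A + (fine (n setT))%:E * U A -
    (spread_x n A + spread_y n A))%E by [].
by rewrite (fine_measureK n mA) (fine_measureK U mA)
  (fine_measureK (spread_x n) mA) (fine_measureK (spread_y n) mA).
Qed.

Lemma fine_spread_x n x y : y \in `[0, 1] ->
  fine (spread_x n (box x y)) = fine (n (box x 1)) * y.
Proof. by move=> y01; rewrite spread_xE // (fine_measureK n (measurable_box _ _)). Qed.

Lemma fine_spread_y n x y : x \in `[0, 1] ->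
  fine (spread_y n (box x y)) = x * fine (n (box 1 y)).
Proof. by move=> y01; rewrite spread_yE // (fine_measureK n (measurable_box _ _)). Qed.

Lemma completion_box n x y : x \in `[0, 1] -> y \in `[0, 1] ->
  completion n (box x y) = (fine (n (box x y)) + fine (n setT) * (x * y) -
                    (fine (n (box x 1)) * y + x * fine (n (box 1 y))))%:E.
Proof.
move=> x01 y01; rewrite completionE; last exact: measurable_box.
by rewrite fine_spread_x // fine_spread_y // uniform_squareE.
Qed.

(** On a box, [completion_box] is linear in the values of the measure; [charge_ext] extends
    additivity to all measurable sets. *)
Lemma completionD n n1 n2 :
  (forall A, measurable A -> n A = (n1 A + n2 A)%E) ->
  forall A, measurable A -> completion n A = (completion n1 A + completion n2 A)%E.
Proof.
move=> nE A mA.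
have nD B : measurable B -> fine (n B) = fine (n1 B) + fine (n2 B).
  by move=> mB; rewrite nE // fineD // fin_num_measure.
apply: (charge_ext (n1 := completion n) (n2 := cadd (completion n1) (completion n2))) => //.
move=> x y x01 y01.
rewrite [RHS](_ : _ = (completion n1 (box x y) + completion n2 (box x y))%E) //.
rewrite !completion_box //.
rewrite !nD; try exact: measurable_box; last exact: measurableT.
by rewrite -EFinD; congr EFin; ring.
Qed.

Definition margins_le n c := forall A, measurable (A : set R1) ->
  (n (sqx @^-1` A) <= c%:E * lebesgue_measure A)%E /\
  (n (sqy @^-1` A) <= c%:E * lebesgue_measure A)%E.

(** The margins are carried by the unit interval, so [A] may be cut down to it. *)
Let margins_le_unit n c (nc : margins_le n c) (A : set R1) : measurable A ->
  (n (sqx @^-1` A) <= c%:E * unit_lebesgue R A)%E /\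
  (n (sqy @^-1` A) <= c%:E * unit_lebesgue R A)%E.
Proof.
move=> mA; have := nc (A `&` `[0%R, 1%R]%classic).
have mAI : measurable (A `&` `[0%R, 1%R]%classic : set R1).
  by apply: measurableI => //; exact: measurable_unit.
have -> : sqx @^-1` (A `&` `[0%R, 1%R]%classic) = sqx @^-1` A :> set S.
  by apply/seteqP; split => s /=; [case|split => //; exact: sqx_itv].
have -> : sqy @^-1` (A `&` `[0%R, 1%R]%classic) = sqy @^-1` A :> set S.
  by apply/seteqP; split => s /=; [case|split => //; exact: sqy_itv].
by move/(_ mAI).
Qed.

Let lower_complement (m : {finite_measure set R1 -> \bar R}) c :
  (forall A, measurable A -> (m A <= c%:E * unit_lebesgue R A)%E) ->
  exists k : {finite_measure set R1 -> \bar R},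
    forall A, measurable A -> (c%:E * unit_lebesgue R A = m A + k A)%E.
Proof.
move=> mc.
pose n : {charge set R1 -> \bar R} :=
  cadd (cscale c (charge_of_finite_measure (unit_lebesgue R)))
       (copp (charge_of_finite_measure m)).
have nE A : n A = (c%:E * unit_lebesgue R A - m A)%E by [].
have [A mA|k kE] := @finite_measure_of_charge _ _ _ n.
  by rewrite nE sube_ge0 ?mc // fin_num_measure.
by exists k => A mA; rewrite kE // nE addeC subeK // fin_num_measure.
Qed.

(** With [k] the measure [c lambda - n_x], the difference [c U - spread_x n] is the product of [k]
    and [lambda], which is nonnegative. The identity is checked on boxes. *)
Lemma spread_x_le n c A : margins_le n c -> measurable A ->
  (spread_x n A <= c%:E * U A)%E.
Proof.
move=> nc mA.
have [B mB|k kE] := @lower_complement (margin_x n) c.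
  by rewrite margin_xE; have [] := margins_le_unit nc mB.
suff -> : (c%:E * U A = spread_x n A + square_prod k (unit_lebesgue R) A)%E.
  by rewrite leeDl.
apply: (charge_ext (n1 := cscale c (charge_of_finite_measure U))
  (n2 := cadd (charge_of_finite_measure (spread_x n))
    (charge_of_finite_measure (square_prod k (unit_lebesgue R))))) => // x y _ _.
rewrite [LHS](_ : _ = (c%:E * U (box x y))%E) //.
rewrite [RHS](_ : _ = (spread_x n (box x y) + square_prod k (unit_lebesgue R) (box x y))%E) //.
rewrite !square_prodE muleA kE; last exact: measurable_clamp_seg.
by rewrite ge0_muleDl.
Qed.

Lemma spread_y_le n c A : margins_le n c -> measurable A ->
  (spread_y n A <= c%:E * U A)%E.
Proof.
move=> nc mA.
have [B mB|k kE] := @lower_complement (margin_y n) c.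
  by rewrite margin_yE; have [] := margins_le_unit nc mB.
suff -> : (c%:E * U A = spread_y n A + square_prod (unit_lebesgue R) k A)%E.
  by rewrite leeDl.
apply: (charge_ext (n1 := cscale c (charge_of_finite_measure U))
  (n2 := cadd (charge_of_finite_measure (spread_y n))
    (charge_of_finite_measure (square_prod (unit_lebesgue R) k)))) => // x y _ _.
rewrite [LHS](_ : _ = (c%:E * U (box x y))%E) //.
rewrite [RHS](_ : _ = (spread_y n (box x y) + square_prod (unit_lebesgue R) k (box x y))%E) //.
rewrite !square_prodE muleCA kE; last exact: measurable_clamp_seg.
by rewrite ge0_muleDr.
Qed.

Let in01 : (0 : R) \in `[0, 1] /\ (1 : R) \in `[0, 1].
Proof. by rewrite !in_itv /= !lexx ler01. Qed.

(** The copula is the distribution function of [E]. Monotonicity and the margins give its range and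
    groundedness; the rectangle inequality is inclusion-exclusion for [box x1 y2] and [box x2 y1]
    inside [box x2 y2]. *)
Lemma margins_copula (E : {finite_measure set S -> \bar R}) :
  (forall x, x \in `[0, 1] -> E (box x 1) = x%:E /\ E (box 1 x) = x%:E) ->
  exists C : R -> R -> R, copula C /\ induces C E.
Proof.
move=> Emarg; have [i0 i1] := in01.
have le_E A B : measurable A -> measurable B -> A `<=` B -> fine (E A) <= fine (E B).
  move=> mA mB AB; rewrite fine_le ?fin_num_measure //.
  by rewrite le_measure // inE.
exists (fun x y => fine (E (box x y))); split; last first.
  by move=> x y x01 y01; rewrite -(fine_measureK E) //; exact: measurable_box.
have mono x1 x2 y1 y2 : x1 <= x2 -> y1 <= y2 -> box x1 y1 `<=` box x2 y2.
  move=> x12 y12 s [] /=; rewrite !in_itv /= => /andP[s0 s1] /andP[t0 t1].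
  by split; rewrite /= in_itv /= ?s0 ?t0 ?(le_trans s1) ?(le_trans t1).
split.
- move=> x y x01 y01; rewrite in_itv /= fine_ge0 //=.
  have := @le_E _ _ (measurable_box x y) (measurable_box 1 1).
  rewrite (proj1 (Emarg _ i1)) /=; apply.
  by move: x01 y01; rewrite !in_itv /= => /andP[_ ?] /andP[_ ?]; exact: mono.
- move=> x y; rewrite !in_itv /= => /andP[x0 x1] /andP[y0 y1].
  split; apply/eqP; rewrite eq_le fine_ge0 // andbT.
    have := @le_E _ _ (measurable_box x 0) (measurable_box 1 0).
    by rewrite (proj2 (Emarg _ i0)) /=; apply; exact: mono.
  have := @le_E _ _ (measurable_box 0 y) (measurable_box 0 1).
  by rewrite (proj1 (Emarg _ i0)) /=; apply; exact: mono.
- move=> x y x01 y01.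
  by rewrite (proj1 (Emarg _ x01)) (proj2 (Emarg _ y01)).
- move=> x1 x2 y1 y2 _ _ _ _ x12 y12.
  pose A := box x1 y2; pose B := box x2 y1.
  have mA : measurable A by exact: measurable_box.
  have mB : measurable B by exact: measurable_box.
  have AB : A `&` B = box x1 y1.
    apply/seteqP; split => s /=; last by move=> s1; split; apply: mono s1.
    by case=> -[? ?] [? ?]; split.
  have EAB : (E (A `|` B) <= E (box x2 y2))%E.
    apply: le_measure; rewrite ?inE; [exact: measurableU|exact: measurable_box|].
    by move=> s [|]; exact: mono.
  have EU : (E (A `|` B) = E A + E B - E (A `&` B))%E.
    by rewrite measureUfinr // -ge0_fin_numE // fin_num_measure.
  rewrite EU AB (fine_measureK E mA) (fine_measureK E mB)
    (fine_measureK E (measurable_box x1 y1)) in EAB.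
  rewrite (fine_measureK E (measurable_box x2 y2)) in EAB.
  move: EAB; rewrite -[leLHS]/((fine (E A) + fine (E B) - fine (E (box x1 y1)))%:E).
  by rewrite lee_fin -/A -/B; lra.
Qed.

Lemma uniform_square_copula : exists C : R -> R -> R, copula C /\ induces C U.
Proof.
have [i0 i1] := in01; apply: margins_copula => x x01.
by rewrite !uniform_squareE // mulr1 mul1r.
Qed.

(** The negative terms of [completion n] are the two spreads, each at most [c U], so adding [2 c U]
    gives a nonnegative charge. As [completion n] vanishes on [box x 1] and [box 1 x], the margins
    of [E] are those of [U]. *)
Lemma completion_copula n c : 0 < c -> margins_le n c ->
  exists E : {finite_measure set S -> \bar R},
    (exists C : R -> R -> R, copula C /\ induces C E) /\
    forall A, measurable A ->
      ((2 * c)%:E * E A = completion n A + (2 * c)%:E * U A)%E.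
Proof.
move=> c0 nc; have [i0 i1] := in01.
pose e : {charge set S -> \bar R} := cscale ((2 * c)^-1)
  (cadd (completion n) (cscale (2 * c) (charge_of_finite_measure U))).
have eE A : measurable A -> e A = ((2 * c)^-1 *
    (fine (n A) + fine (n setT) * fine (U A) -
      (fine (spread_x n A) + fine (spread_y n A)) + 2 * c * fine (U A)))%:E.
  move=> mA.
  have -> : e A = (((2 * c)^-1)%:E * (completion n A + (2 * c)%:E * U A))%E by [].
  by rewrite completionE // (fine_measureK U mA).
have [A mA|E EE] := @finite_measure_of_charge _ _ _ e.
  rewrite eE // lee_fin mulr_ge0 ?invr_ge0 ?mulr_ge0 ?(ltW c0) //.
  have := spread_x_le nc mA; have := spread_y_le nc mA.
  rewrite (fine_measureK (spread_x n) mA) (fine_measureK (spread_y n) mA)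
    (fine_measureK U mA).
  rewrite -!EFinM !lee_fin => ? ?.
  have : 0 <= fine (n A) by exact: fine_ge0.
  have : 0 <= fine (n setT) * fine (U A) by rewrite mulr_ge0 // fine_ge0.
  by lra.
exists E; split; last first.
  move=> A mA; rewrite EE //.
  have -> : e A = (((2 * c)^-1)%:E * (completion n A + (2 * c)%:E * U A))%E by [].
  rewrite muleA -EFinM divff ?mul1e //.
  by rewrite mulf_neq0 // gt_eqF.
have nT : n setT = n (box 1 1) by rewrite box11.
have c'0 : c != 0 by rewrite gt_eqF.
apply: margins_copula => x x01; split.
  rewrite EE ?eE; try exact: measurable_box.
  rewrite fine_spread_x // fine_spread_y // uniform_squareE // nT.
  by congr EFin => /=; field; rewrite c'0.
rewrite EE ?eE; try exact: measurable_box.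
rewrite fine_spread_x // fine_spread_y // uniform_squareE // nT.
by congr EFin => /=; field; rewrite c'0.
Qed.

End completion_copula.

(** * Absolute continuity of the margins *)

Section lipschitz_charge.
Variable R : realType.
Local Notation R1 := (measurableTypeR R).

(** Nondecreasing and 1-Lipschitz in a single condition, which is stable under replacing [G] by
    [id - G]. *)
Definition increments_le (G : R -> R) := forall a b, a <= b -> 0 <= G b - G a <= b - a.

Lemma increments_le_continuous (G : R -> R) : increments_le G -> continuous G.
Proof.
move=> GL x; apply/cvgrPdist_lt => e e0.
near=> t.
have : `|x - t| < e by near: t; exact: (@nbhsx_ballx R R^o).
rewrite !ltr_norml; have [xt|tx] := leP x t; first by have := GL _ _ xt; lra.
by have := GL _ _ (ltW tx); lra.
Unshelve. all: by end_near. Qed.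

Lemma ex_increments_measure (G : R -> R) : increments_le G ->
  exists m : {measure set R1 -> \bar R},
    forall a b, a <= b -> m `]a, b]%classic = (G b - G a)%:E.
Proof.
move=> GL.
have ndG : {homo G : a b / a <= b}.
  by move=> a b /GL /andP[]; rewrite subr_ge0.
have rcG : right_continuous G.
  by apply: right_continuousW; exact: increments_le_continuous.
pose cG : cumulative R R := HB.pack G (isCumulative.Build R _ R G ndG rcG).
exists (lebesgue_stieltjes_measure cG) => a b ab.
rewrite /= /lebesgue_stieltjes_measure /measure_extension.
by rewrite measurable_mu_extE /=; [rewrite wlength_itv_bnd|exact: is_ocitv].
Qed.

(* The Lebesgue-Stieltjes measures of [G] and [id - G] add up to the Lebesgue
   measure, so that of [G], which is [r], vanishes on null sets. *)
Lemma lipschitz_charge_null (r : {charge set R1 -> \bar R}) (G : R -> R) :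
  increments_le G -> (forall a b, a <= b -> r `]a, b]%classic = (G b - G a)%:E) ->
  forall A, measurable A -> lebesgue_measure A = 0%E -> r A = 0%E.
Proof.
move=> GL rE A mA A0.
have G'L : increments_le (fun x => x - G x).
  by move=> a b ab; have := GL _ _ ab; lra.
have [L LE] := ex_increments_measure GL.
have [L' L'E] := ex_increments_measure G'L.
have addE (m1 m2 : {measure set R1 -> \bar R}) B :
    (measure_add m1 m2 : {measure set R1 -> \bar R}) B = (m1 B + m2 B)%E.
  exact: measure_addE.
have LA : L A = 0%E.
  apply/eqP; rewrite eq_le measure_ge0 andbT -A0.
  rewrite (@lebesgue_measure_unique R (measure_add L L')) //.
    by rewrite addE leeDl.
  move=> _ /ocitvP[->|[[a b] /= /ltW ab ->]]; first by rewrite !measure0.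
  rewrite addE LE // L'E // -EFinD lebesgue_measure_itv /= lte_fin.
  move: ab; rewrite le_eqVlt => /predU1P[->|ab].
    by rewrite ltxx; congr EFin; ring.
  by rewrite ab -EFinB; congr EFin; ring.
have [P [N PN]] := Hahn_decomposition r.
have rPN B : measurable B -> r B = (jordan_pos PN B - jordan_neg PN B)%E.
  by move=> mB; rewrite (jordan_decomp PN mB) [LHS]/cadd /= cscaleN1.
have fp B : measurable B -> jordan_pos PN B \is a fin_num.
  exact: fin_num_measure.
have fn B : measurable B -> jordan_neg PN B \is a fin_num.
  exact: fin_num_measure.
(* The equality of [r] and [L] is put in the form [r^+ = r^- + L], so that uniqueness of measures
   applies; both sides agree on half-open intervals. *)
have : jordan_pos PN A =
    (measure_add (jordan_neg PN) L : {measure set R1 -> \bar R}) A.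
  apply: (@measure_unique _ R R1 (@ocitv R) (fun k => `](- k%:R)%R, k%:R]%classic)) => //.
  - exact: ocitvI.
  - by move=> k; exact: is_ocitv.
  - by rewrite bigcup_itvT.
  - move=> _ /ocitvP[->|[[a b] /= /ltW ab ->]]; first by rewrite !measure0.
    have mab : measurable (`]a, b]%classic : set R1) by exact: measurable_itv.
    rewrite addE LE // -rE // rPN // addeC subeK //; exact: fn.
  - move=> k; rewrite -ge0_fin_numE //; apply: fp; exact: measurable_itv.
rewrite addE LA adde0 rPN // => ->.
by rewrite subee //; exact: fn.
Qed.

End lipschitz_charge.

Lemma ex_charge_pushforward d d' (T1 : measurableType d)
    (T2 : measurableType d') (R : realType)
    (n : {charge set T1 -> \bar R}) (f : T1 -> T2) :
  measurable_fun [set: T1] f ->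
  exists n' : {charge set T2 -> \bar R}, forall A, n' A = n (f @^-1` A).
Proof.
by move=> mf; exists (pushforward n f).
Unshelve. exact: mf.
Qed.

Section absolute_continuity.
Variable R : realType.
Local Notation S := (borel_square R).
Local Notation R1 := (measurableTypeR R).
Variables (mu : {charge set S -> \bar R}) (P N : set S).
Variable PN : hahn_decomposition mu P N.

(* Stated for [p] and [q] so as to apply to both coordinates of the square. *)
Lemma margin_null (p q : S -> R) (F : R -> R -> R) :
  measurable_fun setT (p : S -> R1) -> measurable_fun setT (q : S -> R1) ->
  (forall s, p s \in `[0, 1]) ->
  (forall n : {charge set S -> \bar R},
    (forall x y, x \in `[0, 1] -> y \in `[0, 1] ->
      n (p @^-1` `[0, x] `&` q @^-1` `[0, y]) = 0%E) ->
    forall A, measurable A -> n A = 0%E) ->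
  (forall x y, x \in `[0, 1] -> y \in `[0, 1] ->
    mu (p @^-1` `[0, x] `&` q @^-1` `[0, y]) = (F x y)%:E) ->
  (forall y, y \in `[0, 1] -> F 0 y = 0) ->
  (forall x1 x2 y, x1 \in `[0, 1] -> x2 \in `[0, 1] -> y \in `[0, 1] ->
    x1 <= x2 -> 0 <= F x2 y - F x1 y <= x2 - x1) ->
  forall A, measurable (A : set R1) -> lebesgue_measure A = 0%E ->
    charge_variation PN (p @^-1` A) = 0%E.
Proof.
move=> mp mq p01 ext muF F0 FL A mA A0.
have mpB (B : set R1) : measurable B -> measurable (p @^-1` B).
  by move=> mB; rewrite -[X in measurable X]setTI; exact: mp.
have mqB (B : set R1) : measurable B -> measurable (q @^-1` B).
  by move=> mB; rewrite -[X in measurable X]setTI; exact: mq.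
(* For fixed [y], the charge that maps [X] to the value of [mu] on the points with [p] in [X] and
   [q <= y] has distribution function [F (clamp b) y], whose increments are those of a 1-Lipschitz
   nondecreasing function. *)
have zero_strip (B : set R1) y : measurable B -> lebesgue_measure B = 0%E ->
    y \in `[0, 1] -> mu (p @^-1` B `&` q @^-1` `[0, y]) = 0%E.
  move=> mB B0 y01.
  have mqy : measurable (q @^-1` `[0, y]) by apply: mqB; exact: measurable_itv.
  have [r rE'] := @ex_charge_pushforward _ _ S R1 R (crestr0 mu mqy) p mp.
  have rE (X : set R1) : measurable X -> r X = mu (p @^-1` X `&` q @^-1` `[0, y]).
    by move=> mX; rewrite rE' /= /crestr0 mem_set //; exact: mpB.
  rewrite -rE //.
  have mray b : measurable (`]-oo, b]%classic : set R1) by exact: measurable_itv.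
  have ray b : r `]-oo, b]%classic = (F (clamp b) y)%:E.
    rewrite rE //; have [b0|b0] := ltP b 0.
      rewrite (_ : p @^-1` _ = set0) ?set0I ?charge0.
        by rewrite /clamp min_r ?max_l ?F0 // ltW // (lt_trans b0).
      apply/seteqP; split => s //=; rewrite in_itv /= => sb.
      have := p01 s; rewrite in_itv /= => /andP[s0 _].
      by move: (le_lt_trans sb b0); rewrite ltNge s0.
    rewrite -muF //; last exact: clamp_itv.
    congr (mu (_ `&` _)); apply/seteqP; split => s /=; have := p01 s;
      rewrite !in_itv /= => /andP[s0 s1].
      by move=> sb; rewrite s0 /clamp le_max le_min s1 sb orbT.
    by rewrite s0 /= /clamp le_max le_min => /orP[|/andP[//]] => s0'; apply: le_trans b0.
  apply: (@lipschitz_charge_null R r (fun x => F (clamp x) y)) => //.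
    move=> a b ab; have := nondecreasing_clamp ab => cab.
    have /andP[-> /= h] := FL _ _ _ (clamp_itv a) (clamp_itv b) y01 cab.
    rewrite (le_trans h) // /clamp.
    by case: (leP 1 a) => ?; case: (leP 1 b) => ?; rewrite /Num.max;
      do ?case: ifP; lra.
  move=> a b ab; apply/eqP; rewrite EFinB -!ray.
  rewrite (@itv_bndbnd_setU _ _ -oo%O (BRight a) (BRight b)) //.
  have mab : measurable (`]a, b]%classic : set R1) by exact: measurable_itv.
  rewrite (chargeU r) //.
    by rewrite addeAC subee ?add0e // fin_num_measure.
  by apply/seteqP; split => x //= []; rewrite !in_itv /= => xa /andP[/lt_geF]; rewrite xa.
have mpA := mpB _ mA.
(* The restriction of [mu] to the preimage of [A] vanishes on boxes by [zero_strip], hence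
   everywhere. Taking [B] to be [P] and [N] kills both parts of the variation. *)
have muA B : measurable B -> mu (B `&` p @^-1` A) = 0%E.
  move=> mB; pose n : {charge set S -> \bar R} := crestr0 mu mpA.
  have nE (X : set S) : measurable X -> n X = mu (X `&` p @^-1` A).
    by move=> mX; rewrite /n /= /crestr0 mem_set.
  rewrite -nE //; apply: ext => // x y x01 y01.
  have mx : measurable (`[0, x]%classic : set R1) by exact: measurable_itv.
  have my : measurable (`[0, y]%classic : set R1) by exact: measurable_itv.
  rewrite nE; last by apply: measurableI; [exact: mpB|exact: mqB].
  rewrite setIAC -preimage_setI; apply: zero_strip => //; first exact: measurableI.
  apply/eqP; rewrite eq_le measure_ge0 andbT -A0; apply: le_measure; rewrite ?inE //.
  exact: measurableI.
have [[mP _] [mN _] _ _] := PN.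
rewrite [LHS](_ : _ = (mu (p @^-1` A `&` P) - mu (p @^-1` A `&` N))%E).
  by rewrite ![p @^-1` A `&` _]setIC !muA // sube0.
congr (_ + _)%E.
  by rewrite jordan_posE cjordan_posE /crestr0 mem_set.
by rewrite jordan_negE cjordan_negE /crestr0 mem_set.
Qed.

End absolute_continuity.

(** * Weights that make the margins dominated *)

Section density.
Local Open Scope ereal_scope.

(** The set [P] is there to cut the weighted variation down to one of the two Hahn sets. *)
Lemma finite_measure_density d (T : measurableType d) (R : realType)
    (V : {finite_measure set T -> \bar R}) (w : T -> R) (P : set T) :
  measurable_fun setT w -> (forall s, (0 <= w s <= 1)%R) -> measurable P ->
  exists m : {finite_measure set T -> \bar R},
    forall A, measurable A -> m A = \int[V]_(s in A `&` P) (w s)%:E.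
Proof.
move=> mw w01 mP.
have mEw D : measurable_fun D (EFin \o w).
  by apply/measurable_EFinP; apply: measurable_funTS.
have iw : V.-integrable setT (EFin \o w).
  apply: (le_integrable _ _ _ (finite_measure_integrable_cst V 1%R measurableT)) => //.
  move=> s _ /=; rewrite lee_fin normr1; have /andP[w0 w1] := w01 s.
  by rewrite ger0_norm.
pose n : {charge set T -> \bar R} := crestr0 (induced_charge iw) mP.
have nE A : measurable A -> n A = \int[V]_(s in A `&` P) (w s)%:E.
  by move=> mA; rewrite /n /= /crestr0 mem_set.
have [A mA|m mE] := @finite_measure_of_charge _ _ _ n.
  rewrite nE //; apply: integral_ge0 => s _; rewrite lee_fin.
  by case/andP: (w01 s).
by exists m => A mA; rewrite mE // nE.
Qed.

(* [g = 1 / (1 + f)], where [f] is the density of [m]. *)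
Lemma bounded_margin_weight (R : realType)
    (m : {finite_measure set (measurableTypeR R) -> \bar R}) :
  (forall A, measurable A -> lebesgue_measure A = 0 -> m A = 0) ->
  exists g : R -> R, [/\ measurable_fun setT g, forall u, (0 < g u <= 1)%R &
    forall A, measurable (A : set (measurableTypeR R)) ->
      \int[m]_(u in A) (g u)%:E <= lebesgue_measure A].
Proof.
move=> m_ac.
have mleb : m `<< lebesgue_measure.
  by apply/null_content_dominatesP => A mA; exact: m_ac.
pose f := Radon_Nikodym_SigmaFinite.f m (@lebesgue_measure R).
have f0 u : 0 <= f u by exact: Radon_Nikodym_SigmaFinite.f_ge0.
have ffin u : f u \is a fin_num by exact: Radon_Nikodym_SigmaFinite.f_fin_num.
have mf : measurable_fun setT f.
  exact: measurable_int (Radon_Nikodym_SigmaFinite.f_integrable mleb).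
(* The maximum makes [1 / max(1, v)] nonincreasing in [v] on the whole line, which gives
   measurability. *)
pose g u : R := (Num.max 1 (1 + fine (f u)))^-1%R.
have gE u : g u = ((1 + fine (f u))^-1)%R.
  by rewrite /g max_r // lerDl fine_ge0.
have mg : measurable_fun setT g.
  apply: (@measurableT_comp _ _ _ _ _ _ (fun v : R => (Num.max 1 v)^-1)%R).
    apply: nonincreasing_measurable => // a b ab.
    rewrite lef_pV2 ?posrE ?lt_max ?ltr01 //.
    by rewrite ge_max !le_max lexx ab orbT.
  apply: measurable_funD => //; apply: measurableT_comp => //.
have g01 u : (0 < g u <= 1)%R.
  have fu : (0 <= fine (f u))%R by exact: fine_ge0.
  have fu1 : (0 < 1 + fine (f u))%R by lra.
  by rewrite gE invr_gt0 invf_le1 // fu1 /=; lra.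
exists g; split => // A mA.
have mEg D : measurable_fun D (EFin \o g).
  by apply/measurable_EFinP; apply: measurable_funTS.
have g0 u : 0 <= (g u)%:E by rewrite lee_fin; case/andP: (g01 u) => /ltW.
(* The integral becomes that of [g f = f / (1 + f) <= 1] against the Lebesgue measure. *)
rewrite -(Radon_Nikodym_SigmaFinite.change_of_variables mleb) //.
rewrite -[leRHS]mul1e -integral_cst //.
apply: ge0_le_integral => //.
- by move=> u _; rewrite mule_ge0.
- apply: emeasurable_funM; first exact: mEg.
  by apply: measurable_funTS.
- move=> u _; rewrite -/(f u) -(fineK (ffin u)) -EFinM lee_fin gE.
  have fu : (0 <= fine (f u))%R by exact: fine_ge0.
  by rewrite mulrC ler_pdivrMr; lra.
Qed.

End density.

Lemma le_integral_pushforward d d' (T1 : measurableType d)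
    (T2 : measurableType d') (R : realType) (V : {finite_measure set T1 -> \bar R})
    (m : {finite_measure set T2 -> \bar R}) (p : T1 -> T2) (g : T1 -> R) (h : T2 -> R) :
  measurable_fun setT p -> (forall B, m B = V (p @^-1` B)) ->
  measurable_fun setT g -> measurable_fun setT h ->
  (forall s, 0 <= g s) -> (forall u, 0 <= h u) -> (forall s, g s <= h (p s)) ->
  forall A, measurable A ->
    (\int[V]_(s in p @^-1` A) (g s)%:E <= \int[m]_(u in A) (h u)%:E)%E.
Proof.
move=> mp mE mg mh g0 h0 gh A mA.
have mpA : measurable (p @^-1` A) by rewrite -[X in measurable X]setTI; exact: mp.
have -> : (m : set T2 -> \bar R) = pushforward V p by apply/funext => B; rewrite mE.
rewrite ge0_integral_pushforward //.
- apply: ge0_le_integral => //.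
  + by move=> s _; rewrite lee_fin.
  + by apply/measurable_EFinP; apply: measurable_funTS.
  + by apply/measurable_EFinP; apply: measurable_funTS; exact: measurableT_comp.
  + by move=> s _; rewrite lee_fin.
- by apply/measurable_EFinP; apply: measurable_funTS.
- by move=> u _; rewrite lee_fin.
Qed.

Section decomposition.
Variable R : realType.
Local Notation S := (borel_square R).
Local Notation R1 := (measurableTypeR R).

Lemma quasi_copula_weight (mu : {charge set S -> \bar R}) (Q : R -> R -> R)
    (P N : set S) (PN : hahn_decomposition mu P N) :
  quasi_copula Q -> induces Q mu ->
  exists (V : {finite_measure set S -> \bar R}) (g : S -> R),
    [/\ forall A, measurable A -> V A = charge_variation PN A,
      measurable_fun setT g,
      forall s, 0 < g s <= 1 &
      forall A, measurable (A : set R1) ->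
        (\int[V]_(s in sqx @^-1` A) (g s)%:E <= lebesgue_measure A)%E /\
        (\int[V]_(s in sqy @^-1` A) (g s)%:E <= lebesgue_measure A)%E].
Proof.
move=> qQ iQ.
have [A mA|V VE] := @finite_measure_of_charge _ _ _ (charge_variation PN).
  exact: measure_ge0.
have acx A : measurable (A : set R1) -> lebesgue_measure A = 0%E ->
    charge_variation PN (sqx @^-1` A) = 0%E.
  apply: (@margin_null R mu P N PN sqx sqy Q).
  - exact: measurable_sqx.
  - exact: measurable_sqy.
  - exact: sqx_itv.
  - move=> n n0; apply: (charge_ext (n2 := czero)) => x y x01 y01.
    exact: n0.
  - by move=> x y x01 y01; rewrite -iQ.
  - move=> y y01; exact: (proj2 (quasi_copula_grounded qQ y01 y01)).
  - move=> x1 x2 y x1i x2i y01 x12; rewrite subr_ge0.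
    rewrite (quasi_copula_nondecreasingl qQ) //=.
    have := quasi_copula_lipschitz qQ x1i y01 x2i y01.
    rewrite subrr normr0 addr0 (ger0_norm (x := x2 - x1)) ?subr_ge0 //.
    exact: le_trans (ler_norm _).
have acy A : measurable (A : set R1) -> lebesgue_measure A = 0%E ->
    charge_variation PN (sqy @^-1` A) = 0%E.
  apply: (@margin_null R mu P N PN sqy sqx (fun y x => Q x y)).
  - exact: measurable_sqy.
  - exact: measurable_sqx.
  - exact: sqy_itv.
  - move=> n n0; apply: (charge_ext (n2 := czero)) => x y x01 y01.
    by rewrite /box setIC; exact: n0.
  - by move=> x y x01 y01; rewrite -iQ // setIC.
  - move=> y y01; exact: (proj1 (quasi_copula_grounded qQ y01 y01)).
  - move=> x1 x2 y x1i x2i y01 x12; rewrite subr_ge0.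
    rewrite (quasi_copula_nondecreasingr qQ) //=.
    have := quasi_copula_lipschitz qQ y01 x1i y01 x2i.
    rewrite subrr normr0 add0r (ger0_norm (x := x2 - x1)) ?subr_ge0 //.
    exact: le_trans (ler_norm _).
have [|gx [mgx gx01 gxV]] := @bounded_margin_weight R (margin_x V).
  move=> A mA A0; rewrite margin_xE VE; last exact: measurable_sqx_preimage.
  exact: acx.
have [|gy [mgy gy01 gyV]] := @bounded_margin_weight R (margin_y V).
  move=> A mA A0; rewrite margin_yE VE; last exact: measurable_sqy_preimage.
  exact: acy.
have mx : measurable_fun setT (gx \o (sqx : S -> R)).
  by apply: measurableT_comp => //; exact: measurable_sqx.
have my : measurable_fun setT (gy \o (sqy : S -> R)).
  by apply: measurableT_comp => //; exact: measurable_sqy.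
(* One factor for each margin: both are at most 1, so the product lies below either of them and
   inherits both bounds. *)
exists V, ((gx \o sqx) \* (gy \o sqy)); split => //.
- exact: measurable_funM.
- move=> s /=; have /andP[a0 a1] := gx01 (sqx s).
  have /andP[b0 b1] := gy01 (sqy s).
  by rewrite mulr_gt0 //= mulr_ile1 // ltW.
- have g0 s : 0 <= ((gx \o sqx) \* (gy \o sqy)) s.
    by rewrite /= mulr_ge0 // ltW //; [case/andP: (gx01 (sqx s))|
      case/andP: (gy01 (sqy s))].
  move=> A mA; split.
    rewrite (le_trans _ (gxV _ mA)) //.
    apply: (@le_integral_pushforward _ _ S R1 R V _ sqx) => //.
    + exact: measurable_sqx.
    + by move=> B; rewrite margin_xE.
    + exact: measurable_funM.
    + by move=> u; rewrite ltW //; case/andP: (gx01 u).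
    + move=> s; rewrite /= ler_piMr //.
        by rewrite ltW //; case/andP: (gx01 (sqx s)).
      by case/andP: (gy01 (sqy s)).
  rewrite (le_trans _ (gyV _ mA)) //.
  apply: (@le_integral_pushforward _ _ S R1 R V _ sqy) => //.
  + exact: measurable_sqy.
  + by move=> B; rewrite margin_yE.
  + exact: measurable_funM.
  + by move=> u; rewrite ltW //; case/andP: (gy01 u).
  + move=> s; rewrite /= ler_piMl //.
      by rewrite ltW //; case/andP: (gy01 (sqy s)).
    by case/andP: (gx01 (sqx s)).
Qed.

End decomposition.

(** * Pieces with small margins *)

Section small_pieces.
Variable R : realType.
Local Notation S := (borel_square R).
Local Notation R1 := (measurableTypeR R).
Variables (V : {finite_measure set S -> \bar R}) (g : S -> R).
Hypotheses (mg : measurable_fun setT g) (g01 : forall s, 0 < g s <= 1).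
Hypothesis gV : forall A, measurable (A : set R1) ->
  (\int[V]_(s in sqx @^-1` A) (g s)%:E <= lebesgue_measure A)%E /\
  (\int[V]_(s in sqy @^-1` A) (g s)%:E <= lebesgue_measure A)%E.

(** Any positive null sequence with divergent sum would fit: divergence drives [W] to 1, while the
    vanishing terms control its increments. *)
Let W n s := Num.min 1 (series harmonic n * g s).

Let W01 n s : 0 <= W n s <= 1.
Proof.
have /andP[gs0 _] := g01 s.
rewrite /W ge_min lexx le_min ler01 mulr_ge0 ?(ltW gs0) //.
by apply: sumr_ge0 => k _; exact: harmonic_ge0.
Qed.

Let mW n : measurable_fun setT (W n).
Proof.
have m1 : measurable_fun setT (cst 1 : S -> R) by exact: measurable_cst.
have mt : measurable_fun setT (cst (series harmonic n) : S -> R) by exact: measurable_cst.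
exact: measurable_minr m1 (measurable_funM mt mg).
Qed.

Let increment_W n s : 0 <= W n.+1 s - W n s <= harmonic n * g s.
Proof.
have /andP[gs0 _] := g01 s.
have h0 : 0 <= harmonic n * g s by rewrite mulr_ge0 ?harmonic_ge0 // ltW.
rewrite /W seriesSr mulrDl.
move: (series _ n * _) (harmonic n * _) h0 => a b b0.
by case: (leP 1 a) => ?; case: (leP 1 (a + b)) => ?; lra.
Qed.

(** Since [g s] is positive and the harmonic series diverges, [W n s] is eventually equal to 1. *)
Let cvg_W s : (fun n => (1 - W n s)%:E) @ \oo --> 0%E.
Proof.
have nd : nondecreasing_seq (series (harmonic : R^nat)).
  by apply: nondecreasing_series => k _ _; exact: harmonic_ge0.
have := nondecreasing_dvgn_lt nd (@dvg_harmonic R) => /cvgryPge dvg.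
have /andP[gs0 _] := g01 s.
apply: cvg_near_cst; near=> n.
rewrite /W min_l ?subrr // -ler_pdivrMr // mul1r.
by near: n; exact: dvg.
Unshelve. all: by end_near. Qed.

Let e n := fine (\int[V]_s (1 - W n s)%:E).

Let remainder01 n s : 0 <= 1 - W n s <= 1.
Proof. by have := W01 n s; lra. Qed.

Let measurable_remainder n D : measurable_fun D (fun s => (1 - W n s)%:E).
Proof.
apply/measurable_EFinP; apply: measurable_funTS; apply: measurable_funB => //.
Qed.

(** Dominated convergence, with the constant 1 as integrable bound because [V] is finite. *)
Let cvg_e : e @ \oo --> 0.
Proof.
have : (\int[V]_s (1 - W n s)%:E)%E @[n --> \oo] --> (\int[V]_(s in setT) (cst 0 s))%E.
  apply: (@dominated_cvg _ _ _ V setT measurableT _ _ (EFin \o cst 1)) => //.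
  - exact: finite_measure_integrable_cst.
  - move=> n s _; have /andP[r0 r1] := remainder01 n s.
    by rewrite /= ger0_norm // lee_fin.
by rewrite integral0 => /fine_cvg.
Qed.

(** The pieces and remainders have densities [W n.+1 - W n] and [1 - W n] with respect to [V] on
    [D]. The bound [e], an integral over the whole square, precedes [D] and so serves both Hahn
    sets. *)
Lemma small_margin_pieces : exists e : nat -> R, e @ \oo --> 0 /\
  forall D, measurable D ->
  exists pc rem : nat -> {finite_measure set S -> \bar R},
    [/\ forall n, margins_le (pc n) (harmonic n),
        forall n A, measurable A -> rem n A = (pc n A + rem n.+1 A)%E,
        forall A, measurable A -> rem 0%N A = V (A `&` D) &
        forall n, fine (rem n setT) <= e n].
Proof.
exists e; split => // D mD.
have mu_ n : measurable_fun setT (fun s => W n.+1 s - W n s).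
  exact: measurable_funB.
have u01 n s : 0 <= W n.+1 s - W n s <= 1.
  by have := increment_W n s; have := W01 n s; have := W01 n.+1 s; lra.
have mr n : measurable_fun setT (fun s => 1 - W n s) by exact: measurable_funB.
have /choice[pc pcE] n := finite_measure_density V (mu_ n) (u01 n) mD.
have /choice[rem remE] n := finite_measure_density V (mr n) (remainder01 n) mD.
have mEu n B : measurable_fun B (fun s => (W n.+1 s - W n s)%:E).
  by apply/measurable_EFinP; exact: measurable_funTS.
exists pc, rem; split.
- move=> n A mA.
  have piece (B : set S) : measurable B ->
      (\int[V]_(s in B) (g s)%:E <= lebesgue_measure A)%E ->
      (pc n B <= (harmonic n)%:E * lebesgue_measure A)%E.
    move=> mB BA; rewrite pcE //.
    have mBD : measurable (B `&` D) by exact: measurableI.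
    apply: (@le_trans _ _ (\int[V]_(s in B) (W n.+1 s - W n s)%:E)%E).
      apply: ge0_subset_integral => //.
      by move=> s _; rewrite lee_fin; case/andP: (u01 n s).
    apply: (@le_trans _ _ ((harmonic n)%:E * \int[V]_(s in B) (g s)%:E)%E).
      have mEg : measurable_fun B (EFin \o g).
        by apply/measurable_EFinP; exact: measurable_funTS.
      rewrite -ge0_integralZl ?lee_fin ?harmonic_ge0 //; last first.
        by move=> s _; rewrite lee_fin ltW //; case/andP: (g01 s).
      apply: ge0_le_integral => //.
      + by move=> s _; rewrite lee_fin; case/andP: (u01 n s).
      + exact: measurable_funeM.
      + by move=> s _; rewrite -EFinM lee_fin; case/andP: (increment_W n s).
    by rewrite lee_pmul2l // lte_fin harmonic_gt0.
  by have [gx gy] := gV mA; split; apply: piece => //;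
    [exact: measurable_sqx_preimage|exact: measurable_sqy_preimage].
- move=> n A mA; rewrite !remE // pcE // -ge0_integralD //.
  + by apply: eq_integral => s _; rewrite -EFinD; congr EFin; ring.
  + exact: measurableI.
  + by move=> s _; rewrite lee_fin; case/andP: (u01 n s).
  + by move=> s _; rewrite lee_fin; case/andP: (remainder01 n.+1 s).
- move=> A mA; rewrite remE //.
  (* The empty harmonic sum makes [W 0] vanish, so the initial remainder is all of [V] on [D]. *)
  under eq_integral do rewrite /W /series /= big_geq // mul0r min_r // subr0.
  by rewrite integral_cst ?mul1e //; exact: measurableI.
- move=> n; rewrite /e remE // setTI fine_le //.
  + by rewrite -[D]setTI -remE // fin_num_measure.
  + have [m mE] := finite_measure_density V (mr n) (remainder01 n) measurableT.
    by rewrite -[X in (\int[V]_(s in X) _)%E]setTI -mE // fin_num_measure.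
  + apply: ge0_subset_integral => //.
    by move=> s _; rewrite lee_fin; case/andP: (remainder01 n s).
Qed.

End small_pieces.

(** * The series *)

(** Two terms of [completion n A] count positively and two negatively, and each lies between 0 and
    the mass of [n]. *)
Lemma completion_bound (R : realType)
    (n : {finite_measure set (borel_square R) -> \bar R}) A : measurable A ->
  `|fine (completion n A)| <= 2 * fine (n setT).
Proof.
move=> mA; have i1 : (1 : R) \in `[0, 1] by rewrite in_itv /= ler01 lexx.
have le_mass (m : {finite_measure set (borel_square R) -> \bar R}) :
    0 <= fine (m A) <= fine (m setT).
  by rewrite fine_ge0 //= fine_le ?fin_num_measure // le_measure // inE.
have nT : n (box 1 1) = n setT by rewrite box11.
have UT : fine (uniform_square R setT) = 1.
  by rewrite -box11 uniform_squareE // mulr1.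
have xT : fine (spread_x n setT) = fine (n setT).
  by rewrite -{1}box11 fine_spread_x // mulr1 nT.
have yT : fine (spread_y n setT) = fine (n setT).
  by rewrite -{1}box11 fine_spread_y // mul1r nT.
have := le_mass n; have := le_mass (uniform_square R).
have := le_mass (spread_x n); have := le_mass (spread_y n).
rewrite completionE //= UT xT yT => Y X /andP[U0 U1] M.
have M0 : 0 <= fine (n setT) by exact: fine_ge0.
have : 0 <= fine (n setT) * fine (uniform_square R A) <= fine (n setT).
  by rewrite mulr_ge0 //= ler_piMr.
by rewrite ler_norml; lra.
Qed.

(** The variation equals [mu] on subsets of [P] and [- mu] on subsets of [N]. *)
Lemma hahn_restriction d (T : measurableType d) (R : realType)
    (mu : {charge set T -> \bar R}) (P N : set T)
    (PN : hahn_decomposition mu P N) A : measurable A ->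
  mu A = (charge_variation PN (A `&` P) - charge_variation PN (A `&` N))%E.
Proof.
move=> mA; have [[mP _] [mN _] _ PN0] := PN.
have posE B : measurable B -> jordan_pos PN B = mu (B `&` P).
  by move=> mB; rewrite jordan_posE cjordan_posE /crestr0 mem_set.
have negE B : measurable B -> jordan_neg PN B = (- mu (B `&` N))%E.
  by move=> mB; rewrite jordan_negE cjordan_negE /crestr0 mem_set.
have mAP : measurable (A `&` P) by exact: measurableI.
have mAN : measurable (A `&` N) by exact: measurableI.
rewrite [charge_variation PN (A `&` P)](_ : _ = mu (A `&` P)); last first.
  rewrite [LHS](_ : _ = (jordan_pos PN (A `&` P) + jordan_neg PN (A `&` P))%E) //.
  rewrite posE // negE // -!setIA setIid PN0 setI0 charge0 oppe0 adde0 //.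
rewrite [charge_variation PN (A `&` N)](_ : _ = (- mu (A `&` N))%E); last first.
  rewrite [LHS](_ : _ = (jordan_pos PN (A `&` N) + jordan_neg PN (A `&` N))%E) //.
  by rewrite posE // negE // -!setIA setIid [N `&` P]setIC PN0 setI0 charge0 add0e.
rewrite oppeK (jordan_decomp PN mA) [LHS]/cadd /= cscaleN1 /=.
by rewrite posE // negE // oppeK.
Qed.

(** A partial sum of [k] terms contains the uniform term and [k.-1./2] complete pairs. *)
Lemma cvg_half_pred : (fun k : nat => k.-1./2) @ \oo --> \oo.
Proof.
move=> U [M _ MU]; exists M.*2.+1 => // k /= Mk; apply: MU => /=.
by rewrite -(doubleK M) half_leq // -ltnS (ltn_predK Mk).
Qed.

Theorem corollary18 (R : realType)
    (mu : {charge set (borel_square R) -> \bar R})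
    (hmu : exists Q : R -> R -> R, quasi_copula Q /\ induces Q mu) :
  exists (gamma : nat -> R)
         (mu_ : nat -> {finite_measure set (borel_square R) -> \bar R}),
    (forall n, exists C : R -> R -> R, copula C /\ induces C (mu_ n)) /\
    tv_series_cvg_to
      (fun n => cscale (gamma n) (charge_of_finite_measure (mu_ n))) mu.
Proof.
have [Q [qQ iQ]] := hmu; have [P [N PN]] := Hahn_decomposition mu.
have [V [g [VE mg g01 gV]]] := quasi_copula_weight PN qQ iQ.
have [e [e0 pieces]] := small_margin_pieces mg g01 gV.
have [[mP _] [mN _] _ _] := PN.
have [p [rp [pM rpS rp0 rpe]]] := pieces P mP.
have [q [rq [qM rqS rq0 rqe]]] := pieces N mN.
have [c [c0 c_cvg cE]] : exists c : nat -> R,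
    [/\ forall n, 0 < c n, c @ \oo --> 0 & c = harmonic].
  exists harmonic; split => //; last exact: cvg_harmonic.
  by move=> n; exact: harmonic_gt0.
rewrite -cE in pM qM.
have /choice[E EP] n := completion_copula (c0 n) (pM n).
have /choice[F FP] n := completion_copula (c0 n) (qM n).
pose U := uniform_square R.
(* Term 0 is [U]; terms [2 j + 1] and [2 j + 2] are [2 c_j E_j] and [- 2 c_j F_j]. *)
pose gamma k : R := if k is j.+1 then
  if odd j then - (2 * c j./2) else 2 * c j./2 else 1.
pose mu_ k := if k is j.+1 then if odd j then F j./2 else E j./2 else U.
exists gamma, mu_; split.
  case=> [|j]; first exact: uniform_square_copula.
  by rewrite /mu_; case: (odd j); [have [] := FP j./2|have [] := EP j./2].
pose S_ := charge_partial_sum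
  (fun n => cscale (gamma n) (charge_of_finite_measure (mu_ n))).
have S_S k A : S_ k.+1 A = (S_ k A + (gamma k)%:E * mu_ k A)%E by [].
have i1 : (1 : R) \in `[0, 1] by rewrite in_itv /= ler01 lexx.
have fineC (n : {charge set (borel_square R) -> \bar R}) A : measurable A ->
    n A = (fine (n A))%:E.
  by move=> mA; rewrite fineK // fin_num_measure.
have muE A : measurable A -> mu A = (fine (rp 0%N A) - fine (rq 0%N A))%:E.
  move=> mA; rewrite (hahn_restriction PN mA) -!VE; try exact: measurableI.
  by rewrite -rp0 // -rq0 // (fine_measureK (rp 0%N) mA) (fine_measureK (rq 0%N) mA).
(* The difference of the initial remainders is [mu], which has mass 1 and uniform margins; the
   completion formula turns it into [mu + U - U - U = mu - U]. *)
have completion_mu A : measurable A ->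
    mu A = (U A + completion (rp 0%N) A - completion (rq 0%N) A)%E.
  apply: (charge_ext (n2 := cadd (cadd (charge_of_finite_measure U)
    (completion (rp 0%N))) (copp (completion (rq 0%N))))) => x y x01 y01.
  rewrite [RHS](_ : _ = (U (box x y) + completion (rp 0%N) (box x y) -
    completion (rq 0%N) (box x y))%E) //.
  rewrite !completion_box // uniform_squareE //.
  have diff u v : u \in `[0, 1] -> v \in `[0, 1] ->
      fine (rp 0%N (box u v)) = Q u v + fine (rq 0%N (box u v)).
    move=> u01 v01; have := muE _ (measurable_box u v).
    by rewrite [LHS](iQ u v u01 v01) => -[->]; ring.
  have -> : mu (box x y) = (Q x y)%:E by exact: iQ.
  have [Qx _] := quasi_copula_margins qQ x01 i1.
  have [_ Qy] := quasi_copula_margins qQ i1 y01.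
  have [Q1 _] := quasi_copula_margins qQ i1 i1.
  rewrite -box11 !diff // Qx Qy Q1; congr EFin; ring.
have S_odd j A : measurable A -> S_ j.*2.+1 A =
    (fine (mu A) - fine (completion (rp j) A) + fine (completion (rq j) A))%:E.
  move=> mA; elim: j => [|j IH].
    rewrite S_S /= mul1e completion_mu // add0e.
    rewrite (fine_measureK U mA) (fineC (completion (rp 0%N)) _ mA)
      (fineC (completion (rq 0%N)) _ mA).
    by congr EFin => /=; ring.
  (* In the next pair the two terms [2 c_j U] cancel, and additivity of the completion passes from
     the remainders [j] to the remainders [j.+1]. *)
  rewrite doubleS S_S S_S IH /gamma /mu_ /= odd_double /= uphalf_double doubleK.
  have [_ /(_ A mA) EA] := EP j; have [_ /(_ A mA) FA] := FP j.
  rewrite EFinN mulNe EA FA.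
  have := completionD (rpS j) mA; have := completionD (rqS j) mA.
  rewrite (fineC (completion (rp j)) _ mA) (fineC (completion (rq j)) _ mA).
  rewrite (fineC (completion (p j)) _ mA) (fineC (completion (q j)) _ mA).
  rewrite (fineC (completion (rp j.+1)) _ mA) (fineC (completion (rq j.+1)) _ mA).
  rewrite (fine_measureK (uniform_square R) mA) => -[hq] [hp].
  by congr EFin => /=; rewrite hq hp; ring.
(* Each completed remainder contributes at most [2 e_j]. For odd [k] the sum ends with [2 c_j E_j]
   without its partner, which adds at most [2 c_j] since [E_j] has mass 1. *)
have bound k A : measurable A -> (`|cadd (S_ k.+1) (copp mu) A| <=
    (4 * e k./2 + 2 * c k./2)%:E)%E.
  move=> mA; set j := k./2.
  have Rp : `|fine (completion (rp j) A)| <= 2 * e j.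
    by rewrite (le_trans (completion_bound (rp j) mA)) // ler_pM2l // rpe.
  have Rq : `|fine (completion (rq j) A)| <= 2 * e j.
    by rewrite (le_trans (completion_bound (rq j) mA)) // ler_pM2l // rqe.
  rewrite [X in `|X|%E](_ : _ = (S_ k.+1 A - mu A)%E) //.
  have := odd_double_half k; case: (boolP (odd k)) => [ok|ek] kE.
    rewrite -kE add1n S_S S_odd // /gamma /mu_ /= odd_double /= doubleK -/j.
    have [[C [cC iC]] _] := EP j.
    have /andP[E0 E1] : 0 <= fine (E j A) <= 1.
      have ET : E j setT = 1%E.
        rewrite -box11 [LHS](iC 1 1 i1 i1).
        by have [-> _] := copula_margins cC i1 i1.
      rewrite fine_ge0 //= -[leRHS]/(fine 1%E) -ET fine_le ?fin_num_measure //.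
      by rewrite le_measure // inE.
    rewrite (fine_measureK (E j) mA) (fineC mu _ mA).
    move: (fine (completion (rp j) A)) (fine (completion (rq j) A)) Rp Rq.
    move: (c j) (c0 j) => h h0 cp cq; rewrite /= lee_fin.
    have : 0 <= 2 * h * fine (E j A) <= 2 * h.
      by rewrite mulr_ge0 ?mulr_ge0 ?ler_piMr ?mulr_ge0 // ltW.
    by rewrite !ler_norml; lra.
  rewrite -kE add0n S_odd // -/j (fineC mu _ mA).
  move: (fine (completion (rp j) A)) (fine (completion (rq j) A)) Rp Rq.
  move: (c j) (c0 j) => h h0 cp cq; rewrite /= lee_fin.
  by rewrite !ler_norml; lra.
(* The outer factor 2 is the one of [tv_norm_le]. *)
pose b j : R := 2 * (4 * e j + 2 * c j).
rewrite /tv_series_cvg_to.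
apply: (@squeeze_cvge _ _ _ _ (cst 0%E) _ (fun k => (b k.-1./2)%:E)).
(* The estimate [bound] concerns nonempty partial sums, hence the start at 1. *)
- exists 1%N => // -[//|k] _; rewrite /= tv_norm_ge0 /=.
  by apply: tv_norm_le => A mA; exact: bound.
- exact: cvg_cst.
- apply/cvg_EFin; first by near=> k.
  have bcvg : b @ \oo --> 0.
    rewrite -[X in _ --> X](_ : 2 * (4 * 0 + 2 * 0) = 0 :> R);
      last by rewrite !mulr0 addr0 mulr0.
    apply: cvgMr; apply: cvgD; apply: cvgMr => //; exact: c_cvg.
  exact: (cvg_comp _ _ cvg_half_pred bcvg).
Unshelve. all: by end_near. Qed.
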